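(* Consider a random variable $X$ with a distribution $\mathbb{P}$ in $\mathcal{P}_{(\mu,b,d)}$. Then, for $t\in[0,b]$, $$\sup_{\mathbb{P}\in\mathcal{P}_{(\mu,b,d)}}\mathbb{P}(X\ge t)=\sup_{\mathbb{P}\in\mathcal{P}_{(\mu,b,d)}}\mathbb{P}(X>t)=\begin{cases}1, & t\in[0,\tau_1],\\ \frac{\mu}{t}-\frac{d(b-t)}{2t(b-\mu)}, & t\in[\tau_1,\mu],\\ 1-\frac{d}{2\mu}, & t\in[\mu,\tau_2],\\ \frac{d}{2(t-\mu)}, & t\in[\tau_2,b],\end{cases}$$ with $\tau_1$ and $\tau_2$ given by $$\tau_1=\mu-\frac{d(b-\mu)}{2(b-\mu)-d},\qquad \tau_2=\mu+\frac{d\mu}{2\mu-d}.$$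
   Context: Let $\mu,b,d\in\mathbb{R}_+$. $\mathcal{P}_{(\mu,b,d)}$ is the set of all probability measures $\mathbb{P}$ on the Borel $\sigma$-algebra of $[0,b]$ (distributions of a random variable $X$) such that $\mathbb{P}(X\in[0,b])=1$, $\mathbb{E}_{\mathbb{P}}[X]=\mu$ and $\mathbb{E}_{\mathbb{P}}[|X-\mu|]=d$.
   Formalization: Equality of the two suprema is claimed except at t=b with d>0, t=0 with τ₁=0, and t=μ with d=0, where it is false; the 2nd and 4th formulas are claimed only for t>0 and t>μ (nonzero denominators); the set of distributions is assumed nonempty. *)

(* Defs.v *)
From mathcomp Require Import all_boot all_order all_algebra.
From mathcomp Require Import all_classical all_reals all_analysis.

Set Implicit Arguments.
Unset Strict Implicit.
Unset Printing Implicit Defensive.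

Import Order.TTheory GRing.Theory Num.Theory.

Local Open Scope classical_set_scope.
Local Open Scope ring_scope.

(* A distribution on [0, b] is represented by a Borel probability on the whole
   line giving mass 1 to [0, b]; the random variable is the identity map.
   Since |X| <= b almost surely, both expectations are those of integrable
   functions, so they are never junk values. *)
Definition ambiguity_set (R : realType) (mu b d : R) :
    set (probability (measurableTypeR R) R) :=
  [set P : probability (measurableTypeR R) R |
    [/\ P [set x | 0 <= x <= b] = 1%E,
        ('E_P[fun x => x] = mu%:E)%E &
        ('E_P[fun x => `|x - mu|%R] = d%:E)%E]].

Definition sup_tail_ge (R : realType) (mu b d t : R) : \bar R :=
  ereal_sup [set P [set x | t <= x] | P in ambiguity_set mu b d].

Definition sup_tail_gt (R : realType) (mu b d t : R) : \bar R :=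
  ereal_sup [set P [set x | t < x] | P in ambiguity_set mu b d].

(* When the ambiguity set is nonempty and d > 0, one has 0 < mu < b and both
   denominators below are positive.  When d = 0, the convention x / 0 = 0
   gives tau1 = tau2 = mu. *)
Definition tau1 (R : realType) (mu b d : R) : R :=
  mu - d * (b - mu) / (2 * (b - mu) - d).

Definition tau2 (R : realType) (mu d : R) : R :=
  mu + d * mu / (2 * mu - d).

(* Main.v *)
From HB Require Import structures.
Require Import Defs.
From mathcomp Require Import all_boot all_order all_algebra.
From mathcomp Require Import all_classical all_reals all_analysis.
From mathcomp Require Import measurable_realfun.
From mathcomp Require Import ring lra.

Set Implicit Arguments.
Unset Strict Implicit.
Unset Printing Implicit Defensive.

Import Order.TTheory GRing.Theory Num.Theory.
Import numFieldNormedType.Exports.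

Local Open Scope classical_set_scope.
Local Open Scope ring_scope.

(** The value of a tail probability over distributions on [0, b] with fixed
    mean mu and mean absolute deviation d is a moment problem, and it is solved
    by linear programming duality.

    Upper bounds. If the indicator of an event lies below
    a + c (x - mu) + e |x - mu| on [0, b], integrating gives the bound a + e d
    ([ambiguity_set_dual_bound]). Such functions are exactly the continuous
    functions that are affine on each side of mu, so for the event t <= X one
    looks for a two-piece affine majorant of the step function at t that is as
    small as possible:
    - the constant 1;
    - for t <= mu, the function through (0, 0), (t, 1) and (b, 1) with its kink
      at mu;
    - for mu <= t, either min (x / mu, 1) or (x - mu)^+ / (t - mu).
    Writing l and r for the slopes left and right of mu and a for the value at
    mu, the bound is a + (r - l) d / 2, because the positive and negative parts
    of X - mu both have expectation d / 2. These give the four branches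
    ([sup_tail_ge_le1], [sup_tail_ge_below_mean], [sup_tail_ge_above_mean],
    [sup_tail_ge_far_tail]).

    Lower bounds. Complementary slackness says that an optimal distribution
    sits where the majorant touches the step function: on {0, t, b} when
    tau1 <= t <= mu and on {0, mu, t} when tau2 <= t. The moment conditions
    determine the three weights, and tau1 and tau2 are precisely the thresholds
    at which one weight (at 0, respectively at mu) vanishes
    ([tail_sup_below_mean], [tail_sup_above_mean]). The two constant branches
    are attained by the degenerate distributions at t = tau1 and t = tau2.

    Strict inequality. The lower bounds are proved for any event containing the
    relevant atoms. On the branches where an atom is at t itself, the event
    t < X is served by the optimal distributions for y slightly larger than t,
    whose values k / (y - m) + l converge to the value at t. The constant
    branches need no limit as long as t lies strictly below tau1 or tau2. *)

(** * Probabilities with finite support *)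

Lemma finite_support_probability d (T : measurableType d) (R : realType)
    (n : nat) (w : nat -> R) (x : nat -> T) :
  (forall i, 0 <= w i) -> \sum_(i < n) w i = 1 ->
  exists P : probability T R,
    (forall A, P A = (\sum_(i < n) w i * \1_A (x i))%:E) /\
    (forall f : T -> R, measurable_fun [set: T] f ->
      'E_P[f] = (\sum_(i < n) w i * f (x i))%:E)%E.
Proof.
move=> w_ge0 w_sum1.
pose m i : {measure set T -> \bar R} :=
  mscale (NngNum (w_ge0 i)) (\d_(x i)).
have mE A : msum m n A = (\sum_(i < n) w i * \1_A (x i))%:E.
  by rewrite /msum -sumEFin; apply: eq_bigr => i _; rewrite EFinM.
have mT : msum m n [set: T] = 1%E.
  rewrite mE -w_sum1; congr (_%:E); apply: eq_bigr => i _.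
  by rewrite indicT mulr1.
pose P : probability T R :=
  HB.pack (Measure.sort (msum m n : {measure set T -> \bar R}))
    (Measure_isProbability.Build _ _ _ (msum m n) mT).
(* the change-of-measure lemmas for sums and scalings are about nonnegative
   integrands; a general f is split into its positive and negative parts *)
have ge0_intE (g : T -> R) : measurable_fun [set: T] g ->
    (forall y, 0 <= g y) ->
    (\int[msum m n]_y (g y)%:E = (\sum_(i < n) w i * g (x i))%:E)%E.
  move=> /measurable_EFinP mg g_ge0.
  have g_ge0' y : [set: T] y -> (0 <= (EFin \o g) y)%E by rewrite lee_fin.
  rewrite ge0_integral_measure_sum// -sumEFin; apply: eq_bigr => i _.
  by rewrite ge0_integral_mscale// integral_dirac// diracT mul1e EFinM.
exists P; split=> [A|f mf]; first exact: mE.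
rewrite unlock integralE.
rewrite funerpos funerneg !ge0_intE.
- rewrite -EFinB -sumrB; congr (_%:E); apply: eq_bigr => i _.
  by rewrite -mulrBr -[in RHS](funrposBneg f).
- exact: measurable_funrneg.
- exact: funrneg_ge0.
- exact: measurable_funrpos.
- exact: funrpos_ge0.
Qed.

(** * Duality bounds *)

(** Weak duality. The mean and the mean absolute deviation fix the expectation
    of the majorant; the majoration is only needed on [0, b], where all the mass
    is, so the integrals are compared after discarding a negligible set.
    Integrability comes for free from the finiteness of d. *)
Lemma ambiguity_set_dual_bound (R : realType) (mu b d a c e : R)
    (P : probability (measurableTypeR R) R) (A : set (measurableTypeR R)) :
  ambiguity_set mu b d P -> measurable A ->
  (forall x : R, 0 <= x <= b -> \1_A x <= a + c * (x - mu) + e * `|x - mu|) ->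
  (P A <= (a + e * d)%:E)%E.
Proof.
move=> [Psupp Pmean Pdev] mA majA.
pose T := measurableTypeR R.
pose X : T -> R := fun x => x.
pose dev : T -> R := fun x => x - mu.
pose adev : T -> R := fun x => `|x - mu|.
have mdev : measurable_fun [set: T] dev.
  by apply: measurable_funB => //; exact: measurable_id.
have Ldev : dev \in Lfun P 1.
  apply/Lfun1_integrable/integrableP; split; first exact/measurable_EFinP.
  by move: Pdev; rewrite unlock /= => ->; rewrite ltry.
have Ladev : adev \in Lfun P 1 := Lfun_norm Ldev.
have Lcst r : (cst r : T -> R) \in Lfun P 1 by exact: Lfun_cst.
have Lscale r (f : T -> R) : f \in Lfun P 1 -> r \o* f \in Lfun P 1.
  move=> Lf; rewrite (_ : r \o* f = r *: f) ?rpredZ//.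
  by apply/funext => x /=; rewrite mulrC.
have Edev : ('E_P[dev] = 0)%E.
  have LX : X \in Lfun P 1.
    have -> : X = dev + cst mu by apply/funext => x; rewrite fctE /X /dev /= subrK.
    exact: rpredD.
  by rewrite (_ : dev = X \- cst mu)// expectationB// Pmean expectation_cst subee.
pose g : T -> R := (cst a \+ c \o* dev) \+ e \o* adev.
have Lac : cst a \+ c \o* dev \in Lfun P 1 by apply: rpredD => //; exact: Lscale.
have Lg : g \in Lfun P 1 by apply: rpredD => //; exact: Lscale.
have Eg : ('E_P[g] = (a + e * d)%:E)%E.
  rewrite expectationD //; last exact: Lscale.
  rewrite expectationD//; last exact: Lscale.
  by rewrite !expectationZl// Edev Pdev expectation_cst mule0 adde0 EFinD EFinM.
have LA : (\1_A : T -> R) \in Lfun P 1.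
  by apply/Lfun1_integrable; exact: integrable_indic.
rewrite -Eg -expectation_indic// -sube_ge0 ?expectation_fin_num//.
rewrite -expectationB// unlock.
have mI : measurable ([set x | 0 <= x <= b] : set T).
  by rewrite (_ : [set x | _] = `[0, b]%classic)//; exact: measurable_itv.
rewrite (@negligible_integral _ _ _ P setT (~` [set x : T | 0 <= x <= b]))//.
- rewrite setTD setCK; apply: integral_ge0 => x /= xI.
  rewrite lee_fin subr_ge0 (le_trans (majA x xI))// /g /= /dev /adev.
  by rewrite (mulrC c) (mulrC e).
- exact: measurableC.
- by apply/Lfun1_integrable; rewrite rpredB.
- by have := probability_setC P mI; rewrite Psupp subee.
Qed.

(** Both suprema of the theorem are of this form, so a distribution reaching a
    given value serves the large and the strict tail event at once. *)
Definition tail_sup (R : realType) (mu b d : R) (A : set R) : \bar R :=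
  ereal_sup [set P A | P in @ambiguity_set R mu b d].

Lemma measurable_set_ge (R : realType) (t : R) :
  measurable ([set x | t <= x] : set (measurableTypeR R)).
Proof. by rewrite -set_itvcy; exact: measurable_itv. Qed.

Lemma measurable_set_gt (R : realType) (t : R) :
  measurable ([set x | t < x] : set (measurableTypeR R)).
Proof. by rewrite -set_itvoy; exact: measurable_itv. Qed.

(** Weak duality for the empty event: a source of constraints on (mu, b, d). *)
Lemma ambiguity_set_affine_ge0 (R : realType) (mu b d a c e : R) :
  ambiguity_set mu b d !=set0 ->
  (forall x : R, 0 <= x <= b -> 0 <= a + c * (x - mu) + e * `|x - mu|) ->
  0 <= a + e * d.
Proof.
move=> [P PA] aff_ge0.
have maj x : 0 <= x <= b -> \1_set0 x <= a + c * (x - mu) + e * `|x - mu|.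
  by rewrite indic0; exact: aff_ge0.
have := ambiguity_set_dual_bound PA measurable0 maj.
by rewrite measure0 lee_fin.
Qed.

(** The form in which duality is used: a is the value of the majorant at mu,
    and l and r are its slopes on the left and on the right of mu. *)
Lemma sup_tail_ge_dual (R : realType) (mu b d t a l r : R) :
  (forall x : R, 0 <= x -> x <= mu -> x <= b -> (t <= x)%R%:R <= a - l * (mu - x)) ->
  (forall x : R, 0 <= x -> mu <= x -> x <= b -> (t <= x)%R%:R <= a + r * (x - mu)) ->
  (sup_tail_ge mu b d t <= (a + (r - l) * (d / 2))%:E)%E.
Proof.
move=> majl majr; apply: ge_ereal_sup => _ [P PA <-].
have -> : a + (r - l) * (d / 2) = a + (r - l) / 2 * d by lra.
apply: (@ambiguity_set_dual_bound _ mu b d a ((l + r) / 2)) => //.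
  exact: measurable_set_ge.
move=> x /andP[x0 xb]; rewrite indicE.
rewrite (_ : (x \in _) = (t <= x)); last by apply/idP/idP; rewrite inE.
have [xmu|mux] := leP x mu.
  apply: (le_trans (majl x x0 xmu xb)).
  by rewrite ler0_norm ?subr_le0//; lra.
apply: (le_trans (majr x x0 (ltW mux) xb)).
by rewrite gtr0_norm ?subr_gt0//; lra.
Qed.

Lemma three_atoms_le_tail_sup (R : realType) (mu b d x y z p q r : R) (A : set R) :
  measurable (A : set (measurableTypeR R)) ->
  [/\ 0 <= p, 0 <= q & 0 <= r] ->
  [/\ 0 <= x <= b, 0 <= y <= b & 0 <= z <= b] ->
  p + q + r = 1 ->
  p * x + q * y + r * z = mu ->
  p * `|x - mu| + q * `|y - mu| + r * `|z - mu| = d ->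
  ((p * \1_A x + q * \1_A y + r * \1_A z)%:E <= tail_sup mu b d A)%E.
Proof.
move=> mA [p0 q0 r0] [xb yb zb] sum1 mean dev.
have sum3 (f : R -> R) :
    \sum_(i < 3) nth 0 [:: p; q; r] i * f (nth 0 [:: x; y; z] i) =
    p * f x + q * f y + r * f z.
  by rewrite !big_ord_recr big_ord0 /= add0r.
have [||P [PE EE]] := @finite_support_probability _ (measurableTypeR R) R 3
  (nth 0 [:: p; q; r]) (nth 0 [:: x; y; z]).
- by case=> [|[|[|i]]] //=; rewrite nth_nil.
- by rewrite !big_ord_recr big_ord0 /= add0r.
apply: ereal_sup_ubound; exists P; last by rewrite PE sum3.
split.
- rewrite PE sum3 !indicE !mem_set//.
  by rewrite !mulr1 sum1.
- by rewrite EE// (sum3 id) mean.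
- rewrite EE ?(sum3 (fun x => `|x - mu|)) ?dev//.
  apply: measurableT_comp => //.
  by apply: measurable_funB => //; exact: measurable_id.
Qed.

(** * Feasibility and the two thresholds *)

(** The second inequality integrates the fact that the convex function
    |x - mu| lies below its chord over [0, b]; it is stated multiplied by b,
    which avoids dividing by a possibly null b. *)
Lemma ambiguity_set_feasible (R : realType) (mu b d : R) :
  0 <= mu -> 0 <= b -> ambiguity_set mu b d !=set0 ->
  [/\ mu <= b, b * d <= 2 * mu * (b - mu) & d <= b].
Proof.
move=> mu0 b0 ne.
have mub : mu <= b.
  have /(_ (b - mu) (-1) 0) := ambiguity_set_affine_ge0 ne.
  rewrite mul0r addr0 subr_ge0; apply => x /andP[x0 xb]; lra.
split=> //.
  have := @ambiguity_set_affine_ge0 _ _ _ _ (2 * mu * (b - mu)) (b - 2 * mu) (- b) ne.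
  rewrite mulNr subr_ge0; apply => x /andP[x0 xb].
  have [xmu|mux] := leP x mu.
    by rewrite ler0_norm ?subr_le0//; nra.
  by rewrite gtr0_norm ?subr_gt0//; nra.
have := @ambiguity_set_affine_ge0 _ _ _ _ b 0 (- 1) ne.
rewrite mulN1r subr_ge0; apply => x /andP[x0 xb].
by rewrite mul0r addr0 mulN1r subr_ge0 ler_norml; lra.
Qed.

Lemma ambiguity_set_nondegenerate (R : realType) (mu b d : R) :
  0 <= mu -> 0 <= b -> 0 < d -> ambiguity_set mu b d !=set0 ->
  [/\ 0 < mu, mu < b & b * d <= 2 * mu * (b - mu)].
Proof.
move=> mu0 b0 d0 ne; have [mub bd db] := ambiguity_set_feasible mu0 b0 ne.
have bd0 : 0 < b * d by rewrite mulr_gt0//; lra.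
have prod0 : 0 < mu * (b - mu) by lra.
split=> //.
  rewrite lt_neqAle mu0 andbT; apply/eqP => mu_eq0.
  by move: prod0; rewrite -mu_eq0 mul0r ltxx.
rewrite lt_neqAle mub andbT; apply/eqP => mu_eq.
by move: prod0; rewrite mu_eq subrr mulr0 ltxx.
Qed.

(** The equation is the form in which tau1 is used: 2 (t - mu) (b - mu) +
    d (b - t), the numerator of the weight at 0 in the extremal distribution on
    {0, t, b}, is nonnegative exactly from tau1 on. *)
Lemma tau1_equation (R : realType) (mu b d : R) :
  0 < mu -> mu < b -> 0 <= d -> b * d <= 2 * mu * (b - mu) ->
  [/\ 0 < 2 * (b - mu) - d, 0 <= tau1 mu b d, tau1 mu b d <= mu
    & (mu - tau1 mu b d) * (2 * (b - mu) - d) = d * (b - mu)].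
Proof.
move=> mu0 mub d0 bd.
have D0 : 0 < 2 * (b - mu) - d by nra.
have eq1 : (mu - tau1 mu b d) * (2 * (b - mu) - d) = d * (b - mu).
  by rewrite /tau1; field; rewrite gt_eqF.
split=> //.
- by rewrite /tau1 subr_ge0 ler_pdivrMr//; nra.
- by rewrite /tau1 gerBl divr_ge0 ?mulr_ge0//; lra.
Qed.

(** Likewise, (t - mu) (2 mu - d) - d mu is the numerator of the weight at mu in
    the extremal distribution on {0, mu, t}. *)
Lemma tau2_equation (R : realType) (mu b d : R) :
  0 < mu -> mu < b -> 0 <= d -> b * d <= 2 * mu * (b - mu) ->
  [/\ 0 < 2 * mu - d, tau2 mu d <= b, mu <= tau2 mu d
    & (tau2 mu d - mu) * (2 * mu - d) = d * mu].
Proof.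
move=> mu0 mub d0 bd.
have D0 : 0 < 2 * mu - d by nra.
have eq2 : (tau2 mu d - mu) * (2 * mu - d) = d * mu.
  by rewrite /tau2; field; rewrite gt_eqF.
split=> //.
- by rewrite /tau2 -lerBrDl ler_pdivrMr//; nra.
- by rewrite /tau2 lerDl divr_ge0 ?mulr_ge0//; lra.
Qed.

(** * Upper bounds *)

Lemma sup_tail_ge_le1 (R : realType) (mu b d t : R) : (sup_tail_ge mu b d t <= 1)%E.
Proof.
have := @sup_tail_ge_dual _ mu b d t 1 0 0.
rewrite subrr mul0r addr0; apply => x _ _ _.
  by rewrite mul0r subr0 lern1 leq_b1.
by rewrite mul0r addr0 lern1 leq_b1.
Qed.

(** The majorant goes linearly from (0, 0) through (t, 1) up to mu, then linearly
    down to (b, 1). *)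
Lemma sup_tail_ge_below_mean (R : realType) (mu b d t : R) :
  0 < t -> t <= mu -> mu < b ->
  (sup_tail_ge mu b d t <= (mu / t - d * (b - t) / (2 * t * (b - mu)))%:E)%E.
Proof.
move=> t0 tmu mub; have bmu0 : 0 < b - mu by lra.
pose r := (t - mu) / (t * (b - mu)).
have -> : mu / t - d * (b - t) / (2 * t * (b - mu)) = mu / t + (r - t^-1) * (d / 2).
  by rewrite /r; field; rewrite !gt_eqF.
apply: sup_tail_ge_dual => x x0.
- move=> xmu _.
  have -> : mu / t - t^-1 * (mu - x) = x / t by field; rewrite gt_eqF.
  have [tx|xt] := leP t x; first by rewrite ler_pdivlMr// mul1r.
  by rewrite divr_ge0// ltW.
- move=> mux xb.
  have -> : mu / t + r * (x - mu) = 1 + (mu - t) * (b - x) / (t * (b - mu)).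
    by rewrite /r; field; rewrite !gt_eqF.
  apply: (@le_trans _ _ 1); first by rewrite lern1 leq_b1.
  by rewrite lerDl divr_ge0 ?mulr_ge0//; lra.
Qed.

(** The majorant is min (x / mu, 1). *)
Lemma sup_tail_ge_above_mean (R : realType) (mu b d t : R) :
  0 < mu -> mu <= t -> (sup_tail_ge mu b d t <= (1 - d / (2 * mu))%:E)%E.
Proof.
move=> mu0 mut.
have -> : 1 - d / (2 * mu) = 1 + (0 - mu^-1) * (d / 2) by field; rewrite gt_eqF.
apply: sup_tail_ge_dual => x x0; last first.
  by move=> _ _; rewrite mul0r addr0 lern1 leq_b1.
move=> xmu _; have -> : 1 - mu^-1 * (mu - x) = x / mu by field; rewrite gt_eqF.
have [tx|xt] := leP t x; first by rewrite ler_pdivlMr// mul1r (le_trans mut).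
by rewrite divr_ge0// ltW.
Qed.

(** The majorant is (x - mu)^+ / (t - mu): this is Markov's inequality for the
    positive part of X - mu, whose expectation is d / 2. *)
Lemma sup_tail_ge_far_tail (R : realType) (mu b d t : R) :
  mu < t -> (sup_tail_ge mu b d t <= (d / (2 * (t - mu)))%:E)%E.
Proof.
move=> mut; have tmu0 : 0 < t - mu by lra.
have -> : d / (2 * (t - mu)) = 0 + ((t - mu)^-1 - 0) * (d / 2).
  by field; rewrite gt_eqF.
apply: sup_tail_ge_dual => x x0.
  move=> xmu _; rewrite mul0r subr0.
  by rewrite (lt_geF (le_lt_trans xmu mut)).
move=> mux _; rewrite add0r mulrC.
have [tx|xt] := leP t x; first by rewrite ler_pdivlMr ?mul1r ?lerD2r.
by rewrite divr_ge0//; lra.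
Qed.

Lemma indic_eq1 (R : realType) (A : set R) x : A x -> \1_A x = 1 :> R.
Proof. by move=> Ax; rewrite indicE mem_set. Qed.

(** * Extremal distributions *)

(** The distribution has weights q at t, r at b and the rest at 0. The weight r
    is forced by r (b - mu) = d / 2, the expectation of (X - mu)^+, and q + r
    is then the announced value. *)
Lemma tail_sup_below_mean (R : realType) (mu b d t : R) (A : set R) :
  measurable (A : set (measurableTypeR R)) ->
  0 < mu -> mu < b -> 0 <= d -> b * d <= 2 * mu * (b - mu) ->
  0 < t -> tau1 mu b d <= t -> t <= mu -> A t -> A b ->
  ((mu / t - d * (b - t) / (2 * t * (b - mu)))%:E <= tail_sup mu b d A)%E.
Proof.
move=> mA mu0 mub d0 bd t0 tau1t tmu At Ab.
have [D0 tau1_ge0 tau1mu eq1] := tau1_equation mu0 mub d0 bd.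
have bmu0 : 0 < b - mu by lra.
pose r := d / (2 * (b - mu)).
pose q := (2 * mu * (b - mu) - b * d) / (2 * t * (b - mu)).
have r0 : 0 <= r by rewrite divr_ge0//; lra.
have q0 : 0 <= q by rewrite divr_ge0 ?mulr_ge0//; lra.
have p0 : 0 <= 1 - q - r.
  have -> : 1 - q - r = (2 * (t - mu) * (b - mu) + d * (b - t)) / (2 * t * (b - mu)).
    by rewrite /q /r; field; rewrite !gt_eqF.
  rewrite divr_ge0 ?mulr_ge0//; nra.
apply: (@le_trans _ _ ((1 - q - r) * \1_A 0 + q * \1_A t + r * \1_A b)%:E).
  rewrite lee_fin (indic_eq1 At) (indic_eq1 Ab) !mulr1.
  have -> : mu / t - d * (b - t) / (2 * t * (b - mu)) = q + r.
    by rewrite /q /r; field; rewrite !gt_eqF.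
  by rewrite -addrA lerDr mulr_ge0.
apply: three_atoms_le_tail_sup => //.
- by split; apply/andP; split; lra.
- by ring.
- by rewrite /q /r; field; rewrite !gt_eqF.
- rewrite sub0r normrN gtr0_norm// ler0_norm ?subr_le0// gtr0_norm//.
  by rewrite /q /r; field; rewrite !gt_eqF.
Qed.

(** The distribution has weights p at 0, r at t and the rest at mu: an atom at mu
    does not affect the deviation, so p mu = r (t - mu) = d / 2. *)
Lemma tail_sup_above_mean (R : realType) (mu b d t : R) (A : set R) :
  measurable (A : set (measurableTypeR R)) ->
  0 < mu -> mu < b -> 0 <= d -> b * d <= 2 * mu * (b - mu) ->
  tau2 mu d <= t -> mu < t -> t <= b -> A t ->
  ((d / (2 * (t - mu)))%:E <= tail_sup mu b d A)%E.
Proof.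
move=> mA mu0 mub d0 bd tau2t mut tb At.
have [D0 tau2b tau2_ge eq2] := tau2_equation mu0 mub d0 bd.
have tmu0 : 0 < t - mu by lra.
pose r := d / (2 * (t - mu)).
pose p := d / (2 * mu).
have r0 : 0 <= r by rewrite divr_ge0//; lra.
have p0 : 0 <= p by rewrite divr_ge0//; lra.
have q0 : 0 <= 1 - p - r.
  have -> : 1 - p - r = ((t - mu) * (2 * mu - d) - d * mu) / (2 * mu * (t - mu)).
    by rewrite /p /r; field; rewrite !gt_eqF.
  rewrite divr_ge0 ?mulr_ge0//; try lra.
  by rewrite -eq2 -mulrBl mulr_ge0//; lra.
apply: (@le_trans _ _ (p * \1_A 0 + (1 - p - r) * \1_A mu + r * \1_A t)%:E).
  by rewrite lee_fin (indic_eq1 At) mulr1 lerDr addr_ge0// mulr_ge0.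
apply: three_atoms_le_tail_sup => //.
- by split; apply/andP; split; lra.
- by ring.
- by rewrite /p /r; field; rewrite !gt_eqF.
- rewrite sub0r normrN gtr0_norm// subrr normr0 gtr0_norm//.
  by rewrite /p /r; field; rewrite !gt_eqF.
Qed.

(** At t = tau1 the weight at 0 vanishes, so all the mass is on {tau1, b}. *)
Lemma tail_sup_tau1 (R : realType) (mu b d : R) (A : set R) :
  measurable (A : set (measurableTypeR R)) ->
  0 < mu -> mu < b -> 0 <= d -> b * d <= 2 * mu * (b - mu) ->
  0 < tau1 mu b d -> A (tau1 mu b d) -> A b -> (1 <= tail_sup mu b d A)%E.
Proof.
move=> mA mu0 mub d0 bd tau1_gt0 At Ab.
have [_ _ tau1_le eq1] := tau1_equation mu0 mub d0 bd.
have bmu0 : 0 < b - mu by lra.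
have := tail_sup_below_mean mA mu0 mub d0 bd tau1_gt0 (lexx _) tau1_le At Ab.
congr (_%:E <= _)%E.
have -> : mu / tau1 mu b d - d * (b - tau1 mu b d) / (2 * tau1 mu b d * (b - mu)) =
    1 + ((mu - tau1 mu b d) * (2 * (b - mu) - d) - d * (b - mu)) /
      (2 * tau1 mu b d * (b - mu)).
  by field; rewrite !gt_eqF.
by rewrite eq1 subrr mul0r addr0.
Qed.

(** At t = tau2 the weight at mu vanishes, so the mass outside tau2 is at 0. *)
Lemma tail_sup_tau2 (R : realType) (mu b d : R) (A : set R) :
  measurable (A : set (measurableTypeR R)) ->
  0 < mu -> mu < b -> 0 < d -> b * d <= 2 * mu * (b - mu) ->
  A (tau2 mu d) -> ((1 - d / (2 * mu))%:E <= tail_sup mu b d A)%E.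
Proof.
move=> mA mu0 mub d0 bd At.
have [D2 tau2_le tau2_ge eq2] := tau2_equation mu0 mub (ltW d0) bd.
have mu_tau2 : mu < tau2 mu d by nra.
have := tail_sup_above_mean mA mu0 mub (ltW d0) bd (lexx _) mu_tau2 tau2_le At.
congr (_%:E <= _)%E.
have tm0 : 0 < tau2 mu d - mu by lra.
have -> : d / (2 * (tau2 mu d - mu)) = 1 - d / (2 * mu) -
   ((tau2 mu d - mu) * (2 * mu - d) - d * mu) / (2 * mu * (tau2 mu d - mu)).
  by field; rewrite !gt_eqF.
by rewrite eq2 subrr mul0r subr0.
Qed.

(** * From large to strict inequality *)

Lemma right_cvg_le (R : realType) (f : R -> R) (s u : R) (V : \bar R) :
  s < u -> f y @[y --> s^'+] --> f s ->
  (forall y, s < y < u -> ((f y)%:E <= V)%E) -> ((f s)%:E <= V)%E.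
Proof.
move=> su cvgf le_v.
have fE : (EFin \o f) y @[y --> s^'+] --> (f s)%:E by apply: cvg_EFin => //; exact: nearW.
apply: (cvge_to_le fE).
near=> y; apply: le_v; apply/andP; split; near: y.
- exact: nbhs_right_gt.
- exact: nbhs_right_lt.
Unshelve. all: by end_near. Qed.

Lemma cvg_hyperbola_right (R : realType) (k m l s : R) : m < s ->
  k / (y - m) + l @[y --> s^'+] --> k / (s - m) + l.
Proof.
move=> ms; apply: cvgD; last exact: cvg_cst.
apply: cvgM; first exact: cvg_cst.
apply: cvgV; first by rewrite subr_eq0 gt_eqF.
apply: cvgB; last exact: cvg_cst.
by apply: cvg_at_right_filter; exact: cvg_id.
Qed.

Lemma sup_tail_gt_le_ge (R : realType) (mu b d t : R) :
  (sup_tail_gt mu b d t <= sup_tail_ge mu b d t)%E.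
Proof.
apply: ge_ereal_sup => _ [P PA <-].
apply: (@le_trans _ _ (P [set x | t <= x])); last first.
  by apply: ereal_sup_ubound; exists P.
apply: le_measure; rewrite ?inE; [exact: measurable_set_gt|exact: measurable_set_ge|].
by move=> x /= /ltW.
Qed.

Lemma sup_tail_gt_ge0 (R : realType) (mu b d t : R) :
  ambiguity_set mu b d !=set0 -> (0 <= sup_tail_gt mu b d t)%E.
Proof.
move=> [P PA]; apply: (@le_trans _ _ (P [set x | t < x])) => //.
by apply: ereal_sup_ubound; exists P.
Qed.

(** With d = 0 the only candidate is the point mass at mu. *)
Lemma tail_sup_mad0 (R : realType) (mu b : R) (A : set R) :
  measurable (A : set (measurableTypeR R)) -> 0 <= mu -> mu <= b -> A mu ->
  (1 <= tail_sup mu b 0 A)%E.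
Proof.
move=> mA mu0 mub Amu.
have := @three_atoms_le_tail_sup R mu b 0 mu mu mu 1 0 0 A mA.
rewrite !mul0r !mul1r !addr0 (indic_eq1 Amu) subrr normr0; apply => //.
by split; rewrite mu0 mub.
Qed.

(** The threshold t = 0 has to be treated apart from the general construction,
    whose atoms 0 and t would coincide. *)
Lemma sup_tail_ge0 (R : realType) (mu b d : R) :
  ambiguity_set mu b d !=set0 -> (1 <= sup_tail_ge mu b d 0)%E.
Proof.
move=> [P PA]; apply: (@le_trans _ _ (P [set x | 0 <= x])); last first.
  by apply: ereal_sup_ubound; exists P.
have [<- _ _] := PA.
apply: le_measure; rewrite ?inE; [|exact: measurable_set_ge|].
  by rewrite (_ : [set x | _] = `[0, b]%classic)//; exact: measurable_itv.
by move=> x /= /andP[].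
Qed.

(** * The tail bounds *)

(* The three side conditions on the equality of the two suprema exclude exactly
   the points where it fails: t = b when d > 0, t = mu when d = 0, and t = 0
   when tau1 = 0.  The conditions 0 < t and mu < t in the second and fourth
   cases only exclude a zero denominator (t = tau1 = 0, resp. t = tau2 = mu). *)
Theorem theorem1 (R : realType) (mu b d t : R)
    (mu_ge0 : 0 <= mu) (b_ge0 : 0 <= b) (d_ge0 : 0 <= d)
    (nonempty : ambiguity_set mu b d !=set0)
    (t_in : t \in `[0, b]) :
  [/\ (t = b -> d = 0) -> (d = 0 -> t <> mu) -> (t = 0 -> tau1 mu b d <> 0) ->
        sup_tail_ge mu b d t = sup_tail_gt mu b d t,
      t \in `[0, tau1 mu b d] ->
        sup_tail_ge mu b d t = 1%E,
      t \in `[tau1 mu b d, mu] -> 0 < t ->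
        sup_tail_ge mu b d t =
          (mu / t - d * (b - t) / (2 * t * (b - mu)))%:E,
      t \in `[mu, tau2 mu d] ->
        sup_tail_ge mu b d t = (1 - d / (2 * mu))%:E &
      t \in `[tau2 mu d, b] -> mu < t ->
        sup_tail_ge mu b d t = (d / (2 * (t - mu)))%:E].
Proof.
move: t_in; rewrite !in_itv /= => /andP[t0 tb].
have mge := @measurable_set_ge R.
have mgt := @measurable_set_gt R.
have [d_eq0|d_neq0] := eqVneq d 0.
  have [mub _ _] := ambiguity_set_feasible mu_ge0 b_ge0 nonempty.
  subst d.
  have tau1E : tau1 mu b 0 = mu by rewrite /tau1 !mul0r subr0.
  have tau2E : tau2 mu 0 = mu by rewrite /tau2 !mul0r addr0.
  have ge1 : t <= mu -> sup_tail_ge mu b 0 t = 1%E.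
    move=> tmu; apply/eqP; rewrite eq_le sup_tail_ge_le1 /=.
    exact: tail_sup_mad0.
  have ge0 : mu < t -> sup_tail_ge mu b 0 t = 0%E.
    move=> mut; apply/eqP; rewrite eq_le; apply/andP; split.
      by have := @sup_tail_ge_far_tail R mu b 0 t mut; rewrite mul0r.
    exact: le_trans (sup_tail_gt_ge0 _ nonempty) (sup_tail_gt_le_ge _ _ _ _).
  rewrite tau1E tau2E; split.
  - move=> _ /(_ erefl)/eqP tmu _; apply/eqP; rewrite eq_le sup_tail_gt_le_ge andbT.
    case: (ltgtP t mu) tmu => // [tmu|mut] _.
      by rewrite (ge1 (ltW tmu)); exact: tail_sup_mad0.
    by rewrite (ge0 mut); exact: sup_tail_gt_ge0.
  - by move=> /andP[_ tmu]; exact: ge1.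
  - move=> /andP[mut tmu] tpos; rewrite ge1//.
    have -> : t = mu by apply/le_anti; rewrite tmu mut.
    by rewrite !mul0r subr0 divff// gt_eqF// (lt_le_trans tpos).
  - by move=> /andP[_ tmu]; rewrite ge1// mul0r subr0.
  - by move=> _ mut; rewrite ge0// mul0r.
have d0 : 0 < d by rewrite lt_neqAle eq_sym d_neq0.
have [mu0 mub bd] := ambiguity_set_nondegenerate mu_ge0 b_ge0 d0 nonempty.
have [_ tau1_ge0 tau1_le _] := tau1_equation mu0 mub d_ge0 bd.
have [D2 tau2_le tau2_ge eq2] := tau2_equation mu0 mub d_ge0 bd.
have bmu0 : 0 < b - mu by lra.
have mu_tau2 : mu < tau2 mu d by nra.
split.
- move=> tb_d _ t0_tau1.
  have tltb : t < b.
    rewrite lt_neqAle tb andbT; apply/eqP => /tb_d d_eq0.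
    by rewrite d_eq0 eqxx in d_neq0.
  apply/eqP; rewrite eq_le sup_tail_gt_le_ge andbT.
  have [t_tau1|tau1_t] := ltP t (tau1 mu b d).
    apply: le_trans (sup_tail_ge_le1 _ _ _ _) _.
    by apply: tail_sup_tau1 => //=; rewrite (le_lt_trans t0).
  have tpos : 0 < t.
    rewrite lt_neqAle t0 andbT eq_sym; apply/eqP => t_eq0.
    by apply: t0_tau1 => //; apply/le_anti; rewrite tau1_ge0 -t_eq0 tau1_t.
  have [t_mu|mu_t] := ltP t mu.
    apply: le_trans (sup_tail_ge_below_mean _ tpos (ltW t_mu) mub) _.
    (* on this branch the value is a hyperbola in t with vertical asymptote 0 *)
    pose k := mu - d * b / (2 * (b - mu)); pose l := d / (2 * (b - mu)).
    have fE y : 0 < y -> mu / y - d * (b - y) / (2 * y * (b - mu)) =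
        k / (y - 0) + l.
      by move=> y0; rewrite subr0 /k /l; field; rewrite !gt_eqF.
    rewrite fE//; apply: (@right_cvg_le _ (fun y => k / (y - 0) + l) _ _ _ t_mu).
      exact: cvg_hyperbola_right.
    move=> y /andP[ty ymu]; rewrite -fE; last by rewrite (lt_trans tpos).
    apply: tail_sup_below_mean => //=.
    + by rewrite (lt_trans tpos).
    + by rewrite (le_trans tau1_t)// ltW.
    + exact: ltW.
  have [t_tau2|tau2_t] := ltP t (tau2 mu d).
    apply: le_trans (sup_tail_ge_above_mean _ _ mu0 mu_t) _.
    exact: tail_sup_tau2.
  have mut : mu < t by exact: lt_le_trans tau2_t.
  apply: le_trans (sup_tail_ge_far_tail _ _ mut) _.
  have fE y : mu < y -> d / (2 * (y - mu)) = d / 2 / (y - mu) + 0.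
    by move=> muy; rewrite addr0; field; rewrite subr_eq0 gt_eqF.
  rewrite fE//.
  apply: (@right_cvg_le _ (fun y => d / 2 / (y - mu) + 0) _ _ _ tltb).
    exact: cvg_hyperbola_right.
  move=> y /andP[ty yb]; rewrite -fE; last by rewrite (lt_trans mut).
  apply: tail_sup_above_mean => //=.
  + by rewrite (le_trans tau2_t)// ltW.
  + by rewrite (lt_trans mut).
  + exact: ltW.
- move=> /andP[_ t_tau1]; apply/eqP; rewrite eq_le sup_tail_ge_le1 /=.
  have [tau1_gt0|tau1_le0] := ltP 0 (tau1 mu b d).
    by apply: tail_sup_tau1 => //=; lra.
  have -> : t = 0 by lra.
  exact: sup_tail_ge0.
- move=> /andP[tau1_t tmu] tpos; apply/eqP; rewrite eq_le.
  rewrite sup_tail_ge_below_mean//=.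
  by apply: tail_sup_below_mean => //=; lra.
- move=> /andP[mut t_tau2]; apply/eqP; rewrite eq_le.
  by rewrite sup_tail_ge_above_mean//=; exact: tail_sup_tau2.
- move=> /andP[tau2_t _] mut; apply/eqP; rewrite eq_le.
  by rewrite sup_tail_ge_far_tail//=; apply: tail_sup_above_mean => //=.
Qed.
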